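(* Let $\alpha\in\mathbb{C}$. The Chazy X.a equation with parameter $\alpha$, $$u'''=6u^2u'+\frac{3}{11}(9+7\sqrt3)\left(u'+u^2\right)^2-\frac{1}{22}(4-3\sqrt3)\alpha u'+\frac{1}{44}(3-5\sqrt3)\alpha u^2-\frac{1}{352}(9+7\sqrt3)\alpha^2,$$ can be transformed into the Chazy X.b equation with parameter $\beta=(-2+\sqrt3)\alpha$, $$p'''=6p^2p'+\frac{3}{11}(9-7\sqrt3)\left(p'+p^2\right)^2-\frac{1}{22}(4+3\sqrt3)\beta p'+\frac{1}{44}(3+5\sqrt3)\beta p^2-\frac{1}{352}(9-7\sqrt3)\beta^2,$$ by the birational transformation $g_1:(u;\alpha)\mapsto\left(p;(-2+\sqrt3)\alpha\right)$, where $$p=\frac{(4+\sqrt3)\left\{8(-4+\sqrt3)u^3-8(-4+\sqrt3)uu'-8(-4+\sqrt3)u''-(-7+5\sqrt3)\alpha u\right\}}{13\left\{8u^2+8u'+(\sqrt3-1)\alpha\right\}}.$$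
   Context: Here $u$ and $p$ denote unknown complex functions of the complex variable $t$, primes denote derivatives with respect to $t$ (so $u'=du/dt$, $u''=d^2u/dt^2$), and $\alpha$ is a constant complex parameter. In the notation $g_1:(u;\alpha)\mapsto(p;\beta)$, the first entry is the unknown function and the second entry is the parameter of the equation it satisfies: $\alpha$ for the Chazy X.a equation and $\beta$ for the Chazy X.b equation. The transformation is birational as a map from $(u,u',u'')$ to $(p,p',p'')$, where $p',p''$ are expressed through $u,u',u''$ by means of the equation for $u$.
   Formalization: The target parameter is β = (−2−√3)α instead of the printed (−2+√3)α, which fails for every α ≠ 0: the constant solution u² = (1+√3)α/24 of Chazy X.a maps to p = −u, which does not solve Chazy X.b with the printed β. *)

(* Defs.v *)
From HB Require Import structures.
From mathcomp Require Import all_boot all_order all_algebra.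
From mathcomp Require Import complex.
(* The notations of mpoly are incompatible with those of mathcomp-analysis. *)
From mathcomp Require Import (coercions, canonicals) mpoly.
From mathcomp Require Import classical_sets reals topology normedtype derive.

Set Implicit Arguments.
Unset Strict Implicit.
Unset Printing Implicit Defensive.

Import Order.TTheory GRing.Theory Num.Theory.
Import numFieldNormedType.Exports.

Local Open Scope ring_scope.
Local Open Scope classical_set_scope.

(* R[i] typed as a numClosedFieldType, from which it gets the topology of the
   modulus and, through it, complex differentiability. *)
Definition Cplx (R : realType) : numClosedFieldType := R[i].

(* The right-hand sides and g1 are written over an arbitrary field because they
   are used both on complex values and on rational functions; s stands for
   sqrt 3 in that field. *)
Section Formulas.
Variables (F : fieldType) (s a : F).

Definition chazyXa_rhs (u u' : F) : F :=
  6 * u ^+ 2 * u'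
  + 3 / 11 * (9 + 7 * s) * (u' + u ^+ 2) ^+ 2
  - 1 / 22 * (4 - 3 * s) * a * u'
  + 1 / 44 * (3 - 5 * s) * a * u ^+ 2
  - 1 / 352 * (9 + 7 * s) * a ^+ 2.

Definition chazyXb_rhs (p p' : F) : F :=
  6 * p ^+ 2 * p'
  + 3 / 11 * (9 - 7 * s) * (p' + p ^+ 2) ^+ 2
  - 1 / 22 * (4 + 3 * s) * a * p'
  + 1 / 44 * (3 + 5 * s) * a * p ^+ 2
  - 1 / 352 * (9 - 7 * s) * a ^+ 2.

Definition g1_num (u u' u'' : F) : F :=
  (4 + s) * (8 * (- 4 + s) * u ^+ 3 - 8 * (- 4 + s) * u * u'
             - 8 * (- 4 + s) * u'' - (- 7 + 5 * s) * a * u).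

Definition g1_den (u u' : F) : F :=
  13 * (8 * u ^+ 2 + 8 * u' + (s - 1) * a).

Definition g1 (u u' u'' : F) : F := g1_num u u' u'' / g1_den u u'.

(* g1 multiplies the parameter by - 2 - sqrt 3. This is the inverse of
   - 2 + sqrt 3, the factor of the inverse transformation (g1 with sqrt 3
   replaced by - sqrt 3). The factor can be read off constant solutions, on
   which g1 is u |-> - u: u ^+ 2 = (1 + s) * a / 24 solves Chazy X.a and must be
   equal to (1 - s) * b / 24 for - u to solve Chazy X.b with b = (- 2 -+ s) * a,
   which forces the sign -. *)
Definition g1_param : F := (- 2 - s) * a.

End Formulas.

Section Solutions.
Variable C : numClosedFieldType.

(* u''' = rhs u u' on U, the derivatives of u up to order 3 existing on U. *)
Definition ode3_solution (rhs : C -> C -> C) (U : set C) (u : C -> C) : Prop :=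
  forall t, U t ->
    [/\ derivable u t 1, derivable u^`() t 1, derivable u^`(2) t 1
      & u^`(3) t = rhs (u t) (u^`() t)].

Definition chazyXa_solution (alpha : C) :=
  ode3_solution (chazyXa_rhs (sqrtC 3) alpha).

Definition chazyXb_solution (beta : C) :=
  ode3_solution (chazyXb_rhs (sqrtC 3) beta).

End Solutions.

Local Notation "x %:F" := (@FracField.tofrac _ x) : ring_scope.

Section RationalMaps.
Variables (C : fieldType) (n : nat).

Definition ratfun : fieldType := {fraction (mpoly.mpoly n C)}.

Definition rconst (c : C) : ratfun := (mpoly.mpolyC n c)%:F.

Definition rvar (i : 'I_n) : ratfun := (mpoly.mpolyX C (mpoly.mnm1 i))%:F.

(* A rational map from C^n to C^n is given by its n components. *)
Definition ratmap := 'I_n -> ratfun.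

Definition poly_subst (f : ratmap) (p : mpoly.mpoly n C) : ratfun :=
  mpoly.mmap rconst f p.

(* h is the composite of g with f: g has an expression a / b whose denominator
   does not vanish identically on the image of f. *)
Definition is_rcomp (g : ratfun) (f : ratmap) (h : ratfun) : Prop :=
  exists a b : mpoly.mpoly n C,
    [/\ g = a%:F / b%:F, poly_subst f b != 0
      & h = poly_subst f a / poly_subst f b].

Definition birational (f : ratmap) : Prop :=
  exists f' : ratmap,
    (forall i, is_rcomp (f' i) f (rvar i)) /\
    (forall i, is_rcomp (f i) f' (rvar i)).

(* The derivation \sum_i v_i d/dx_i, first on polynomials, then on fractions
   by the quotient rule. *)
Definition poly_derivation (v : ratmap) (p : mpoly.mpoly n C) : ratfun :=
  \sum_(i < n) (mpoly.mderiv i p)%:F * v i.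

Definition derivation (v : ratmap) (f : ratfun) : ratfun :=
  let a := \n_(repr f) in let b := \d_(repr f) in
  (poly_derivation v a * b%:F - a%:F * poly_derivation v b) / b%:F ^+ 2.

End RationalMaps.

Section PhaseSpace.
Variables (C : numClosedFieldType) (alpha : C).

(* The coordinates rvar 0, rvar 1, rvar 2 stand for u, u', u''; this is d/dt
   along the solutions of Chazy X.a, i.e. u''' is replaced by the right-hand
   side of the equation. *)
Definition chazyXa_field : ratmap C 3 := fun i =>
  tnth [tuple rvar C 1; rvar C 2;
              chazyXa_rhs (rconst 3 (sqrtC 3)) (rconst 3 alpha)
                (rvar C 0) (rvar C 1)] i.

(* (u, u', u'') |-> (p, p', p'') *)
Definition g1_map : ratmap C 3 := fun i =>
  iter i (derivation chazyXa_field)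
    (g1 (rconst 3 (sqrtC 3)) (rconst 3 alpha)
        (rvar C 0) (rvar C 1) (rvar C 2)).

End PhaseSpace.

(* Main.v *)
Require Import Defs.
From HB Require Import structures.
From mathcomp Require Import all_boot all_order all_algebra.
From mathcomp Require Import complex ring.
(* The notations of mpoly are incompatible with those of the analysis files. *)
From mathcomp Require Import (coercions, canonicals) mpoly.
From mathcomp Require Import boolp functions filter.
From mathcomp Require Import classical_sets reals topology normedtype derive.
Import Order.TTheory GRing.Theory Num.Theory.
Import numFieldNormedType.Exports.
Local Open Scope ring_scope.
Local Open Scope classical_set_scope.

(** Write s for sqrt 3, let beta = (- 2 - s) alpha, and put
R = 8 (u' + u^2) + (s - 1) alpha. Then the formula for p is nothing but
p = R' / R - u. Let S be the expression R built from p, with - s for s and beta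
for alpha: S = 8 (p' + p^2) - (s + 1) beta. Substituting p = R' / R - u in S,
a direct computation shows that u solves Chazy X.a if and only if S = k R, where
k = (38 + 21 s) / 11 ([chazyXa_backlund]).

Everything follows from the symmetry of this relation. From S = k R one gets
S' / S = R' / R, so u = S' / S - p; moreover R = k^-1 S, and k^-1 is the value
of k at - s. So p and u may be exchanged in the relation, provided that s becomes
- s and that alpha and beta are exchanged as well. Since Chazy X.b is Chazy X.a
with - s for s, the same equivalence read backwards says that p solves Chazy X.b
([backlund3_chazyXb]). It also follows that the transformation with - s and beta
is the inverse of the given one ([backlund0K], [backlund1K], [backlund2K]).

The relation S = k R expresses p' polynomially in p and R, and so p'' in p, p'
and R' ([backlund1], [backlund2]). For solutions this shows that p is three
times differentiable although u''' is not assumed to be differentiable: p' and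
p'' are polynomials in p, R and R', which involve u, u', u'' only. For
birationality it gives p, p', p'' as explicit elements of the field of rational
functions, so that it remains to know that the derivation along the equation is
indeed a derivation, and that composition with a rational map is compatible
with the field operations. *)

Set Implicit Arguments.
Unset Strict Implicit.
Unset Printing Implicit Defensive.

(** * The transformation and its inverse over a field *)

Section Backlund.
Variable F : fieldType.
Implicit Types s a x y z r : F.

(** The quantity R, as a function of the 1-jet (x, y) of u. *)
Definition riccati s a x y : F := 8 * (y + x ^+ 2) + (s - 1) * a.

(** R' and R'', as functions of the 2-jet (x, y, z) and the 3-jet (x, y, z, r)
of u. *)
Definition riccati1 x y z : F := 8 * (z + 2 * x * y).
Definition riccati2 x y z r : F := 8 * (r + 2 * y ^+ 2 + 2 * x * z).

(** The factor k in S = k R. That 38^2 - 3 * 21^2 = 11^2 makes its inverse its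
own value at - s. *)
Definition unit_factor s : F := (38 + 21 * s) / 11.

(** The components p, p', p'' of the transformation. The last two are solved
from S = k R and S' = k R', which makes the components with - s their inverse
by construction; that they are the derivatives of the first holds along
solutions of Chazy X.a. *)
Definition backlund0 s a x y z : F := riccati1 x y z / riccati s a x y - x.
Definition backlund1 s a x y z : F :=
  (unit_factor s * riccati s a x y - (- s - 1) * g1_param s a) / 8
  - backlund0 s a x y z ^+ 2.
Definition backlund2 s a x y z : F :=
  unit_factor s * riccati1 x y z / 8
  - 2 * backlund0 s a x y z * backlund1 s a x y z.

(** p''' in terms of the 3-jet of u: the derivative of [backlund2]. *)
Definition backlund3 s a x y z r : F :=
  unit_factor s * riccati2 x y z r / 8
  - 2 * backlund1 s a x y z ^+ 2
  - 2 * backlund0 s a x y z * backlund2 s a x y z.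

Hypothesis charF0 : [pchar F] =i pred0.

Lemma natS_neq0 n : n.+1%:R != 0 :> F.
Proof. by rewrite ((pcharf0P F).1 charF0). Qed.
Hint Resolve natS_neq0 : core.

Section Param.
Variables s a : F.
Hypothesis s2 : s ^+ 2 = 3.

Lemma g1_denE x y : g1_den s a x y = 13 * riccati s a x y.
Proof. by rewrite /g1_den /riccati; ring. Qed.

(** Since (4 + s) (s - 4) = - 13, the factor 13 cancels in g1. *)
Lemma g1E x y z : riccati s a x y != 0 -> g1 s a x y z = backlund0 s a x y z.
Proof.
rewrite /g1 /g1_num /g1_den /backlund0 /riccati1 /riccati => W0.
by field: s2; rewrite ?W0 ?natS_neq0.
Qed.

Lemma chazyXb_rhsE x y : chazyXb_rhs s a x y = chazyXa_rhs (- s) a x y.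
Proof. by rewrite /chazyXb_rhs /chazyXa_rhs; ring. Qed.

Lemma unit_factorN : unit_factor (- s) * unit_factor s = 1.
Proof. by rewrite /unit_factor; field: s2. Qed.

Lemma g1_paramK : g1_param (- s) (g1_param s a) = a.
Proof. by rewrite /g1_param; ring: s2. Qed.

(** The key computation: the left-hand side is p' for p = R' / R - u, where r
stands for u''', so that the first equation says that S = k R. *)
Lemma chazyXa_backlund x y z r : riccati s a x y != 0 ->
  riccati2 x y z r / riccati s a x y
    - (riccati1 x y z / riccati s a x y) ^+ 2 - y = backlund1 s a x y z <->
  r = chazyXa_rhs s a x y.
Proof.
move=> W0.
(* The sides of the first equation differ by a nonzero multiple of r - rhs. *)
have H : riccati2 x y z r / riccati s a x y
    - (riccati1 x y z / riccati s a x y) ^+ 2 - y - backlund1 s a x y z =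
  8 / riccati s a x y * (r - chazyXa_rhs s a x y).
  rewrite /backlund1 /backlund0; move: W0.
  rewrite /riccati2 /riccati1 /riccati /chazyXa_rhs /unit_factor /g1_param.
  by move=> W0; field: s2; rewrite ?W0 ?natS_neq0.
have k0 : 8 / riccati s a x y != 0 by rewrite mulf_neq0 ?invr_eq0.
split=> /eqP; rewrite -subr_eq0.
  by rewrite H mulf_eq0 (negbTE k0) subr_eq0 => /eqP.
by move=> E; apply/eqP; rewrite -subr_eq0 H mulf_eq0 E orbT.
Qed.

End Param.

Section Inverse.
Variables s a : F.
Hypothesis s2 : s ^+ 2 = 3.
Let b := g1_param s a.

(** S = k R holds by the choice of [backlund1], and its first two derivatives
by the choice of [backlund2] and [backlund3]. *)
Lemma riccati_backlund x y z :
  riccati (- s) b (backlund0 s a x y z) (backlund1 s a x y z) =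
  unit_factor s * riccati s a x y.
Proof.
rewrite {1}/riccati /backlund1 -/b.
by field; exact: (natS_neq0 7).
Qed.

Lemma riccati1_backlund x y z :
  riccati1 (backlund0 s a x y z) (backlund1 s a x y z) (backlund2 s a x y z) =
  unit_factor s * riccati1 x y z.
Proof.
rewrite {1}/riccati1 /backlund2.
by field; exact: (natS_neq0 7).
Qed.

Lemma riccati2_backlund x y z r :
  riccati2 (backlund0 s a x y z) (backlund1 s a x y z) (backlund2 s a x y z)
    (backlund3 s a x y z r) = unit_factor s * riccati2 x y z r.
Proof.
by rewrite {1}/riccati2 /backlund3; field; exact: (natS_neq0 7).
Qed.

Lemma unit_factor_neq0 : unit_factor s != 0.
Proof.
apply/eqP => k0; have /eqP := unit_factorN s2.
by rewrite k0 mulr0 eq_sym oner_eq0.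
Qed.

(** S = k R and S' = k R' give S' / S = R' / R = p + u. *)
Lemma backlund0K x y z : riccati s a x y != 0 ->
  backlund0 (- s) b (backlund0 s a x y z) (backlund1 s a x y z)
    (backlund2 s a x y z) = x.
Proof.
move=> W0; rewrite {1}/backlund0 riccati_backlund riccati1_backlund.
by rewrite -mulf_div divff ?unit_factor_neq0 // mul1r subKr.
Qed.

Lemma backlund1K x y z : riccati s a x y != 0 ->
  backlund1 (- s) b (backlund0 s a x y z) (backlund1 s a x y z)
    (backlund2 s a x y z) = y.
Proof.
move=> W0; rewrite {1}/backlund1 backlund0K // riccati_backlund.
rewrite mulrA (unit_factorN s2) mul1r opprK (g1_paramK a s2) /riccati.
by field; exact: (natS_neq0 7).
Qed.

Lemma backlund2K x y z : riccati s a x y != 0 ->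
  backlund2 (- s) b (backlund0 s a x y z) (backlund1 s a x y z)
    (backlund2 s a x y z) = z.
Proof.
move=> W0; rewrite {1}/backlund2 backlund0K // backlund1K // riccati1_backlund.
rewrite mulrA (unit_factorN s2) mul1r /riccati1.
by field; exact: (natS_neq0 7).
Qed.

(** [chazyXa_backlund] is used twice: at u it turns Chazy X.a into S = k R, and
at p, with - s for s, it turns R = k^-1 S into Chazy X.b. *)
Lemma backlund3_chazyXb x y z r : riccati s a x y != 0 ->
  r = chazyXa_rhs s a x y ->
  backlund3 s a x y z r = chazyXb_rhs s b (backlund0 s a x y z)
                                          (backlund1 s a x y z).
Proof.
move=> W0 rE; rewrite chazyXb_rhsE.
have k0 := unit_factor_neq0.
have Ns2 : (- s) ^+ 2 = 3 by rewrite sqrrN.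
have E := (chazyXa_backlund s2 z r W0).2 rE.
have V0 : riccati (- s) b (backlund0 s a x y z) (backlund1 s a x y z) != 0.
  by rewrite riccati_backlund mulf_neq0.
apply: (chazyXa_backlund Ns2 (backlund2 s a x y z) _ V0).1.
rewrite backlund1K // riccati_backlund riccati1_backlund riccati2_backlund.
have kV v : unit_factor s * v / (unit_factor s * riccati s a x y) =
    v / riccati s a x y by rewrite -mulf_div divff // mul1r.
by rewrite !kV -E subKr.
Qed.

End Inverse.
End Backlund.

(** * Derivations of a field *)

Section FieldDerivation.
Variables (F : fieldType) (D : F -> F).
Hypothesis derD : {morph D : f g / f + g}.
Hypothesis derM : forall f g, D (f * g) = D f * g + f * D g.

Lemma der0 : D 0 = 0.
Proof. by apply: (addrI (D 0)); rewrite -derD !addr0. Qed.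

Lemma der1 : D 1 = 0.
Proof.
by apply: (addrI (D 1)); have := derM 1 1; rewrite !mulr1 mul1r addr0 => <-.
Qed.

Lemma der_nat k : D k%:R = 0.
Proof. by elim: k => [|k IHk]; rewrite ?der0 // mulrSr derD IHk der1 addr0. Qed.

Lemma derN f : D (- f) = - D f.
Proof. by apply/eqP; rewrite -addr_eq0 -derD addNr der0. Qed.

Lemma derX f k : D (f ^+ k) = k%:R * f ^+ k.-1 * D f.
Proof.
elim: k => [|[|k] IHk]; first by rewrite der1 !mul0r.
  by rewrite expr1 !mul1r.
rewrite exprS derM IHk /= [k.+2%:R]mulrS !exprS; ring.
Qed.

Lemma derV f : D f^-1 = - (D f / f ^+ 2).
Proof.
have [->|f0] := eqVneq f 0; first by rewrite invr0 der0 mul0r oppr0.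
have /eqP : D (f * f^-1) = 0 by rewrite divff // der1.
rewrite derM addrC addr_eq0 => /eqP E; apply: (mulfI f0); rewrite E.
by field.
Qed.

Definition derE := (derN, derD, derM, derX, derV, der_nat, der0, der1).

Hypothesis charF0 : [pchar F] =i pred0.
Variables s a x y z : F.
Hypotheses (Ds : D s = 0) (Da : D a = 0) (Dx : D x = y) (Dy : D y = z).

Lemma der_riccati : D (riccati s a x y) = riccati1 x y z.
Proof. by rewrite /riccati !derE Dx Dy Ds Da /riccati1; ring. Qed.

Hypothesis Dz : D z = chazyXa_rhs s a x y.
Hypothesis s2 : s ^+ 2 = 3.

Lemma der_riccati1 : D (riccati1 x y z) = riccati2 x y z (chazyXa_rhs s a x y).
Proof. by rewrite /riccati1 !derE Dx Dy Dz /riccati2; ring. Qed.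

Lemma der_backlund0 : riccati s a x y != 0 ->
  D (backlund0 s a x y z) = backlund1 s a x y z.
Proof.
move=> W0; rewrite -((chazyXa_backlund charF0 s2 z _ W0).2 (erefl _)).
rewrite /backlund0 derD derM derV derN Dx der_riccati der_riccati1.
by field.
Qed.

Lemma der_backlund1 : riccati s a x y != 0 ->
  D (backlund1 s a x y z) = backlund2 s a x y z.
Proof.
have Dk : D (unit_factor s) = 0 by rewrite /unit_factor !derE Ds; ring.
have Dc : D ((- s - 1) * g1_param s a) = 0.
  by rewrite /g1_param !derE Ds Da; ring.
have D8 : D 8^-1 = 0 by rewrite derV der_nat mul0r oppr0.
move=> W0; rewrite {1}/backlund1 derD derM derN D8 derD derN Dc derM Dk.
rewrite derX der_backlund0 // der_riccati /backlund2.
ring.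
Qed.
End FieldDerivation.

(** * Rational functions: derivations and composition *)

Local Notation "x %:F" := (@FracField.tofrac _ x) : ring_scope.

Lemma fracE (R : idomainType) (x : {fraction R}) :
  x = (\n_(repr x))%:F / (\d_(repr x))%:F.
Proof.
have d0 : (\d_(repr x))%:F != 0 :> {fraction R}.
  by rewrite tofrac_eq0 denom_ratioP.
apply: (canRL (mulfK d0)); rewrite -{1}[x]reprK; apply/eqP.
unlock FracField.tofrac; rewrite -[_ * _]FracField.pi_mul /=.
rewrite eqmodE /= FracField.equivfE /FracField.mulf.
rewrite !numden_Ratio ?mulf_neq0 ?oner_eq0 ?denom_ratioP //.
by rewrite !mulr1 mulrC.
Qed.

Lemma fracP (R : idomainType) (x : {fraction R}) :
  exists a b : R, b != 0 /\ x = a%:F / b%:F.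
Proof.
by exists \n_(repr x), \d_(repr x); split; [exact: denom_ratioP|exact: fracE].
Qed.

(** Equal fractions have equal derivatives: the last hypothesis is the third
one differentiated. *)
Lemma quotient_rule_eq (F : fieldType) (a b c d a' b' c' d' : F) :
  b != 0 -> d != 0 -> a * d = c * b -> a' * d + a * d' = c' * b + c * b' ->
  (a' * b - a * b') / b ^+ 2 = (c' * d - c * d') / d ^+ 2.
Proof.
move=> b0 d0 /(canRL (mulfK d0)) -> /(canRL (addrK _))/(canRL (mulfK d0)) ->.
by field; rewrite b0 d0.
Qed.

(** The quotient rule at (a c) / (b d) and at (a d + c b) / (b d), where a', b',
c', d' stand for the derivatives of a, b, c, d. *)
Lemma quotient_ruleM (F : fieldType) (a b c d a' b' c' d' : F) :
  b != 0 -> d != 0 ->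
  ((a' * c + a * c') * (b * d) - a * c * (b' * d + b * d')) / (b * d) ^+ 2 =
  (a' * b - a * b') / b ^+ 2 * (c / d) + a / b * ((c' * d - c * d') / d ^+ 2).
Proof. by move=> b0 d0; field; rewrite b0 d0. Qed.

Lemma quotient_ruleD (F : fieldType) (a b c d a' b' c' d' : F) :
  b != 0 -> d != 0 ->
  ((a' * d + a * d' + (c' * b + c * b')) * (b * d)
    - (a * d + c * b) * (b' * d + b * d')) / (b * d) ^+ 2 =
  (a' * b - a * b') / b ^+ 2 + (c' * d - c * d') / d ^+ 2.
Proof. by move=> b0 d0; field; rewrite b0 d0. Qed.

Section RatfunTheory.
Variables (C : fieldType) (n : nat).
Local Notation K := (ratfun C n).
Local Notation P := (mpoly.mpoly n C).
Implicit Types (c : C) (f g h : K) (m v w : ratmap C n).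

HB.instance Definition _ := GRing.RMorphism.copy (@rconst C n)
  (@FracField.tofrac P \o @mpoly.mpolyC n C).

Lemma pchar_ratfun : [pchar K] =i [pchar C].
Proof. exact: fmorph_pchar (@rconst C n). Qed.

Section PolyDerivation.
Variable v : ratmap C n.

Lemma poly_derivationD : {morph poly_derivation v : p q / p + q}.
Proof.
move=> p q; rewrite /poly_derivation -big_split; apply: eq_bigr => i _ /=.
by rewrite mpoly.mderivD rmorphD mulrDl.
Qed.

Lemma poly_derivationM p q : poly_derivation v (p * q) =
  poly_derivation v p * q%:F + p%:F * poly_derivation v q.
Proof.
rewrite /poly_derivation mulr_suml mulr_sumr -big_split; apply: eq_bigr => i _.
rewrite mpoly.mderivM rmorphD !rmorphM /=; ring.
Qed.

Lemma poly_derivationC c : poly_derivation v (mpoly.mpolyC n c) = 0.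
Proof.
by rewrite /poly_derivation big1 // => i _; rewrite mpoly.mderivC rmorph0 mul0r.
Qed.

Lemma poly_derivationX i :
  poly_derivation v (mpoly.mpolyX C (mpoly.mnm1 i)) = v i.
Proof.
rewrite /poly_derivation (bigD1 i) //= big1 => [|j ji].
  rewrite mpoly.mderivX mpoly.mnm1E eqxx scale1r.
  rewrite -{1}[mpoly.mnm1 i]mpoly.add0m mpoly.addmK.
  by rewrite mpoly.mpolyX0 rmorph1 mul1r addr0.
by rewrite mpoly.mderivX mpoly.mnm1E eq_sym (negbTE ji) scale0r rmorph0 mul0r.
Qed.

(** [derivation] is defined by the quotient rule on a chosen representative;
any other representative gives the same value. *)
Lemma derivation_frac (p q : P) : q != 0 -> derivation v (p%:F / q%:F) =
  (poly_derivation v p * q%:F - p%:F * poly_derivation v q) / q%:F ^+ 2.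
Proof.
move=> q0; rewrite /derivation.
have := fracE (p%:F / q%:F); set x := repr _ => E.
have qF : q%:F != 0 :> K by rewrite tofrac_eq0.
have dF : (\d_x)%:F != 0 :> K by rewrite tofrac_eq0 denom_ratioP.
have {}E : (\n_x)%:F * q%:F = p%:F * (\d_x)%:F :> K.
  by move/eqP: E; rewrite (eqr_div _ _ qF dF) => /eqP <-.
apply: quotient_rule_eq => //.
rewrite -!poly_derivationM; congr poly_derivation.
by apply/eqP; rewrite -tofrac_eq !rmorphM /= E.
Qed.

End PolyDerivation.

Section Derivation.
Variable v : ratmap C n.
Local Notation D := (derivation v).

Lemma derivation_tofrac p : D p%:F = poly_derivation v p.
Proof.
rewrite -[p%:F]divr1 -(rmorph1 (@FracField.tofrac P)).
rewrite derivation_frac ?oner_eq0 //.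
rewrite -mpoly.mpolyC1 poly_derivationC mpoly.mpolyC1 rmorph1.
by rewrite mulr1 mulr0 subr0 expr1n divr1.
Qed.

Lemma derivation_const c : D (rconst n c) = 0.
Proof. by rewrite derivation_tofrac poly_derivationC. Qed.

Lemma derivation_var i : D (rvar C i) = v i.
Proof. by rewrite derivation_tofrac poly_derivationX. Qed.

Lemma derivationM f g : D (f * g) = D f * g + f * D g.
Proof.
have [a [b [b0 ->]]] := fracP f; have [c [d [d0 ->]]] := fracP g.
rewrite mulf_div -!tofracM !derivation_frac ?mulf_neq0 //.
rewrite !poly_derivationM !tofracM.
by apply: quotient_ruleM; rewrite tofrac_eq0.
Qed.

Lemma derivationD : {morph D : f g / f + g}.
Proof.
move=> f g; have [a [b [b0 ->]]] := fracP f; have [c [d [d0 ->]]] := fracP g.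
rewrite addf_div ?tofrac_eq0 // -!tofracM -tofracD.
rewrite !derivation_frac ?mulf_neq0 //.
rewrite poly_derivationD !poly_derivationM tofracD !tofracM.
by apply: quotient_ruleD; rewrite tofrac_eq0.
Qed.

End Derivation.

Section Composition.
Variable m : ratmap C n.
Local Notation subst := (poly_subst m).
Local Notation comp f g := (is_rcomp f m g).

Lemma poly_substD : {morph subst : p q / p + q}.
Proof. exact: rmorphD. Qed.
Lemma poly_substN : {morph subst : p / - p}.
Proof. exact: rmorphN. Qed.
Lemma poly_substM : {morph subst : p q / p * q}.
Proof. exact: rmorphM. Qed.
Lemma poly_substC c : subst (mpoly.mpolyC n c) = rconst n c.
Proof. exact: mpoly.mmapC. Qed.
Lemma poly_subst1 : subst 1 = 1.
Proof. by rewrite -mpoly.mpolyC1 poly_substC rmorph1. Qed.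
Lemma poly_substX i : subst (mpoly.mpolyX C (mpoly.mnm1 i)) = m i.
Proof. by rewrite /poly_subst mpoly.mmapX mpoly.mmap1U. Qed.

Lemma rcomp_poly (p : P) : comp p%:F (subst p).
Proof.
exists p, 1; rewrite poly_subst1 rmorph1 !divr1.
by split => //; exact: oner_neq0.
Qed.

Lemma rcomp_const c : comp (rconst n c) (rconst n c).
Proof. by rewrite -{2}poly_substC; exact: rcomp_poly. Qed.

Lemma rcomp_var i : comp (rvar C i) (m i).
Proof. by rewrite -poly_substX; exact: rcomp_poly. Qed.

Lemma rcomp_nat k : comp k%:R k%:R.
Proof. by rewrite -(rmorph_nat (@rconst C n)); exact: rcomp_const. Qed.

(** A denominator that survives the substitution is itself nonzero, so the
fractions of [is_rcomp] are genuine ones. *)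
Lemma denom_subst_neq0 (q : P) : subst q != 0 -> q%:F != 0 :> K.
Proof.
by apply: contraNN; rewrite tofrac_eq0 => /eqP ->; rewrite /poly_subst rmorph0.
Qed.

Lemma rcompM f g f' g' : comp f f' -> comp g g' -> comp (f * g) (f' * g').
Proof.
move=> [a [b [-> b0 ->]]] [c [d [-> d0 ->]]]; exists (a * c), (b * d).
split; first by rewrite !tofracM mulf_div.
  by rewrite poly_substM (mulf_neq0 b0 d0).
by rewrite !poly_substM mulf_div.
Qed.

Lemma rcompD f g f' g' : comp f f' -> comp g g' -> comp (f + g) (f' + g').
Proof.
move=> [a [b [-> b0 ->]]] [c [d [-> d0 ->]]]; exists (a * d + c * b), (b * d).
split.
- have [b1 d1] := (denom_subst_neq0 b0, denom_subst_neq0 d0).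
  by rewrite tofracD !tofracM (addf_div _ _ b1 d1).
- by rewrite poly_substM (mulf_neq0 b0 d0).
- by rewrite poly_substD !poly_substM (addf_div _ _ b0 d0).
Qed.

Lemma rcompN f f' : comp f f' -> comp (- f) (- f').
Proof.
move=> [a [b [-> b0 ->]]]; exists (- a), b.
by split; rewrite // ?tofracN ?poly_substN mulNr.
Qed.

Lemma rcompV f f' : f' != 0 -> comp f f' -> comp f^-1 f'^-1.
Proof.
move=> f0 [a [b [-> b0 E]]]; exists b, a.
split; [exact: invf_div | | by rewrite E; exact: invf_div].
by apply: contraNneq f0 => a0; rewrite E a0 mul0r.
Qed.

Lemma rcompX f f' k : comp f f' -> comp (f ^+ k) (f' ^+ k).
Proof.
move=> ff'; elim: k => [|k IHk]; first by rewrite !expr0; exact: (rcomp_nat 1).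
by rewrite !exprS; exact: rcompM.
Qed.

Section RcompBacklund.
Variables (s a x y z x' y' z' : K).
Hypotheses (s_const : comp s s) (a_const : comp a a).
Hypotheses (xx' : comp x x') (yy' : comp y y') (zz' : comp z z').

Lemma rcomp_riccati : comp (riccati s a x y) (riccati s a x' y').
Proof.
exact: (rcompD (rcompM (rcomp_nat 8) (rcompD yy' (rcompX 2 xx')))
  (rcompM (rcompD s_const (rcompN (rcomp_nat 1))) a_const)).
Qed.

Lemma rcomp_riccati1 : comp (riccati1 x y z) (riccati1 x' y' z').
Proof.
exact: (rcompM (rcomp_nat 8)
  (rcompD zz' (rcompM (rcompM (rcomp_nat 2) xx') yy'))).
Qed.

Lemma rcomp_backlund0 : riccati s a x' y' != 0 ->
  comp (backlund0 s a x y z) (backlund0 s a x' y' z').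
Proof.
move=> W0.
exact: (rcompD (rcompM rcomp_riccati1 (rcompV W0 rcomp_riccati)) (rcompN xx')).
Qed.

Hypothesis charF0 : [pchar K] =i pred0.

Lemma rcomp_inv_nat k : comp k.+1%:R^-1 k.+1%:R^-1.
Proof. exact: (rcompV (natS_neq0 charF0 k) (rcomp_nat _)). Qed.

Lemma rcomp_unit_factor : comp (unit_factor s) (unit_factor s).
Proof.
exact: (rcompM (rcompD (rcomp_nat 38) (rcompM (rcomp_nat 21) s_const))
  (rcomp_inv_nat 10)).
Qed.

Lemma rcomp_g1_param : comp (g1_param s a) (g1_param s a).
Proof.
exact: (rcompM (rcompD (rcompN (rcomp_nat 2)) (rcompN s_const)) a_const).
Qed.

Lemma rcomp_backlund1 : riccati s a x' y' != 0 ->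
  comp (backlund1 s a x y z) (backlund1 s a x' y' z').
Proof.
move=> W0; pose c := rcompM (rcompD (rcompN s_const) (rcompN (rcomp_nat 1)))
  rcomp_g1_param.
exact: (rcompD (rcompM (rcompD (rcompM rcomp_unit_factor rcomp_riccati)
  (rcompN c)) (rcomp_inv_nat 7)) (rcompN (rcompX 2 (rcomp_backlund0 W0)))).
Qed.

Lemma rcomp_backlund2 : riccati s a x' y' != 0 ->
  comp (backlund2 s a x y z) (backlund2 s a x' y' z').
Proof.
move=> W0.
exact: (rcompD (rcompM (rcompM rcomp_unit_factor rcomp_riccati1)
  (rcomp_inv_nat 7)) (rcompN (rcompM (rcompM (rcomp_nat 2)
    (rcomp_backlund0 W0)) (rcomp_backlund1 W0)))).
Qed.
End RcompBacklund.
End Composition.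
End RatfunTheory.

(** * Birationality *)

Section BacklundMap.
Variable C : fieldType.
Hypothesis charC0 : [pchar C] =i pred0.
Local Notation K := (ratfun C 3).
Implicit Types s a : C.

Definition backlund_map s a : ratmap C 3 := fun i =>
  let s := rconst 3 s in let a := rconst 3 a in
  let x := rvar C 0 in let y := rvar C 1 in let z := rvar C 2 in
  tnth [tuple backlund0 s a x y z; backlund1 s a x y z; backlund2 s a x y z] i.

Let charK0 : [pchar K] =i pred0.
Proof. by move=> p; rewrite pchar_ratfun charC0. Qed.

(** R is nonzero because some derivation takes it to the nonzero constant 8. *)
Lemma riccati_var_neq0 s a :
  riccati (rconst 3 s) (rconst 3 a) (rvar C 0) (rvar C 1) != 0.
Proof.
(* This z makes y + x ^+ 2 have derivative 1 when x' = y and y' = z. *)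
set x := rvar C 0; set y := rvar C 1; pose z : K := 1 - 2 * x * y.
pose v : ratmap C 3 := fun i => if i == 0 then y else z.
have := der_riccati (derivationD v) (derivationM v) (derivation_const v s)
  (derivation_const v a) (derivation_var v 0) (derivation_var v 1).
apply: contra_eq_neq => ->.
rewrite (der0 (derivationD v)) /riccati1 subrK mulr1.
by rewrite eq_sym (natS_neq0 charK0 7).
Qed.

Lemma ord3P (Q : 'I_3 -> Prop) : Q 0 -> Q 1 -> Q 2 -> forall i, Q i.
Proof.
move=> Q0 Q1 Q2 [[|[|[|//]]] i3].
- by rewrite (_ : Ordinal i3 = 0) //; apply: val_inj.
- by rewrite (_ : Ordinal i3 = 1) //; apply: val_inj.
- by rewrite (_ : Ordinal i3 = 2) //; apply: val_inj.
Qed.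

(** The same lemma serves for both composites, as the transformation with - s
and [g1_param s a] is of the same form. *)
Lemma backlund_mapK s a : s ^+ 2 = 3 -> forall i,
  is_rcomp (backlund_map (- s) (g1_param s a) i) (backlund_map s a) (rvar C i).
Proof.
move=> s2.
have S2 : rconst 3 s ^+ 2 = 3 by rewrite -rmorphXn s2 rmorph_nat.
set S := rconst 3 s in S2; set A := rconst 3 a.
have NS : rconst 3 (- s) = - S by rewrite rmorphN.
have B : rconst 3 (g1_param s a) = g1_param S A.
  by rewrite /g1_param rmorphM rmorphB rmorphN rmorph_nat.
have W0 := riccati_var_neq0 s a; rewrite -/S -/A in W0.
have k0 := unit_factor_neq0 charK0 S2.
have c1 := @rcomp_const C 3 (backlund_map s a) (- s).
have c2 := @rcomp_const C 3 (backlund_map s a) (g1_param s a).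
rewrite NS in c1; rewrite B in c2.
have v := @rcomp_var C 3 (backlund_map s a).
have V0 : riccati (- S) (g1_param S A)
    (backlund_map s a 0) (backlund_map s a 1) != 0.
  by rewrite [X in X != 0](riccati_backlund charK0 S A) (mulf_neq0 k0 W0).
apply: ord3P; rewrite {1}/backlund_map NS B.
- rewrite -[in X in is_rcomp _ _ X](backlund0K charK0 S2 (rvar C 2) W0).
  exact: rcomp_backlund0.
- rewrite -[in X in is_rcomp _ _ X](backlund1K charK0 S2 (rvar C 2) W0).
  exact: rcomp_backlund1.
- rewrite -[in X in is_rcomp _ _ X](backlund2K charK0 S2 (rvar C 2) W0).
  exact: rcomp_backlund2.
Qed.
End BacklundMap.

Section Birational.
Variables (C : numClosedFieldType) (a : C).
Let s : C := sqrtC 3.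

(** The iterated derivatives of g1 along Chazy X.a have the closed forms
[backlund1] and [backlund2]. *)
Lemma g1_mapE : g1_map a = backlund_map s a.
Proof.
have s2 : s ^+ 2 = 3 := sqrtCK 3.
have K0 : [pchar (ratfun C 3)] =i pred0.
  by move=> p; rewrite pchar_ratfun pchar_num.
have S2 : rconst 3 s ^+ 2 = 3 by rewrite -rmorphXn s2 rmorph_nat.
pose v := chazyXa_field a.
have W0 := riccati_var_neq0 (@pchar_num C) s a.
have Dx : derivation v (rvar C 0) = rvar C 1 := derivation_var v 0.
have Dy : derivation v (rvar C 1) = rvar C 2 := derivation_var v 1.
have Dz := derivation_var v 2.
have Ds := derivation_const v s.
have Da := derivation_const v a.
have [dD dM] := (derivationD v, derivationM v).
have D0 := der_backlund0 dD dM K0 Ds Da Dx Dy Dz S2 W0.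
have D1 := der_backlund1 dD dM K0 Ds Da Dx Dy Dz S2 W0.
have g0 := g1E K0 S2 (rvar C 2) W0.
apply/funext; apply: ord3P; rewrite /g1_map /=.
- exact: g0.
- by rewrite g0; exact: D0.
- by rewrite g0 -/v D0; exact: D1.
Qed.

Lemma birational_g1_map : birational (g1_map a).
Proof.
have s2 : s ^+ 2 = 3 := sqrtCK 3.
have Ns2 : (- s) ^+ 2 = 3 by rewrite sqrrN.
rewrite g1_mapE; exists (backlund_map (- s) (g1_param s a)); split => i.
  exact: backlund_mapK (@pchar_num C) _ _ s2 i.
have := backlund_mapK (@pchar_num C) (g1_param s a) Ns2 i.
by rewrite opprK (g1_paramK a s2).
Qed.

End Birational.

(** * Solutions *)

Section Analysis.
Variable C : numClosedFieldType.
Implicit Types (f g : C -> C) (U : set C).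

Lemma is_derive_inv f (t df : C) : f t != 0 -> is_derive t 1 f df ->
  is_derive t 1 (fun y => (f y)^-1) (- (df / f t ^+ 2)).
Proof.
move=> ft0 [fd <-]; apply: DeriveDef; first exact: derivableV.
by rewrite deriveV // mulrC -mulNr.
Qed.

Lemma eq_on_is_derive U f g t (df : C) : open U -> U t ->
  (forall t, U t -> f t = g t) -> is_derive t 1 f df -> is_derive t 1 g df.
Proof.
move=> Uo Ut fg; apply: near_eq_is_derive.
by apply: filterS (open_nbhs_nbhs (conj Uo Ut)) => r; exact: fg.
Qed.

(** On an open set, a function whose successive derivatives are known there
has them as iterated derivatives, even if the functions f1, f2, f3 that give
them differ from the latter outside of U. *)
Lemma ode3_solutionI (rhs : C -> C -> C) U f0 f1 f2 f3 : open U ->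
  (forall t, U t -> is_derive t 1 f0 (f1 t)) ->
  (forall t, U t -> is_derive t 1 f1 (f2 t)) ->
  (forall t, U t -> is_derive t 1 f2 (f3 t)) ->
  (forall t, U t -> f3 t = rhs (f0 t) (f1 t)) ->
  ode3_solution rhs U f0.
Proof.
move=> Uo d0 d1 d2 E.
have e1 t : U t -> f1 t = f0^`() t.
  by move=> Ut; have [_ <-] := d0 _ Ut; rewrite derive1E.
have {}d1 t : U t -> is_derive t 1 f0^`() (f2 t).
  by move=> Ut; exact: (eq_on_is_derive Uo Ut e1 (d1 _ Ut)).
have e2 t : U t -> f2 t = f0^`(2) t.
  by move=> Ut; have [_ <-] := d1 _ Ut; rewrite -derive1E.
have {}d2 t : U t -> is_derive t 1 f0^`(2) (f3 t).
  by move=> Ut; exact: (eq_on_is_derive Uo Ut e2 (d2 _ Ut)).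
move=> t Ut; have [p0 _] := d0 _ Ut; have [p1 _] := d1 _ Ut.
have [p2 q2] := d2 _ Ut.
split; [exact: p0|exact: p1|exact: p2|].
by rewrite -(e1 t Ut) -(E t Ut) derive1nS derive1E q2.
Qed.

Lemma is_derive_solution (rhs : C -> C -> C) U f : ode3_solution rhs U f ->
  forall t, U t -> [/\ is_derive t 1 f (f^`() t),
    is_derive t 1 f^`() (f^`(2) t)
    & is_derive t 1 f^`(2) (rhs (f t) (f^`() t))].
Proof.
move=> sol t /sol [d0 d1 d2 <-].
split; apply: DeriveDef; rewrite -?derive1E.
- exact: d0.
- by [].
- exact: d1.
- by [].
- exact: d2.
- by [].
Qed.

Section Backlund.
Variables (s a : C) (u0 u1 u2 u3 : C -> C) (t : C).
Hypothesis d0 : is_derive t 1 u0 (u1 t).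
Hypothesis d1 : is_derive t 1 u1 (u2 t).
Hypothesis d2 : is_derive t 1 u2 (u3 t).

Lemma is_derive_riccati : is_derive t 1 (fun t => riccati s a (u0 t) (u1 t))
  (riccati1 (u0 t) (u1 t) (u2 t)).
Proof.
have E : (fun t => riccati s a (u0 t) (u1 t)) =
  8 \*: (u1 + u0 ^+ 2) + cst ((s - 1) * a) by apply/funext.
rewrite E; apply: (is_derive_eq (is_deriveD
  (is_deriveZ 8 (is_deriveD d1 (is_deriveX 2 d0))) (is_derive_cst _ _ _))).
by rewrite /riccati1 /GRing.scale_fun /GRing.scale /=; ring.
Qed.

Lemma is_derive_riccati1 : is_derive t 1
  (fun t => riccati1 (u0 t) (u1 t) (u2 t))
  (riccati2 (u0 t) (u1 t) (u2 t) (u3 t)).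
Proof.
have E : (fun t => riccati1 (u0 t) (u1 t) (u2 t)) =
  8 \*: (u2 + (2 \*: u0) * u1) by apply/funext.
rewrite E; apply: (is_derive_eq
  (is_deriveZ 8 (is_deriveD d2 (is_deriveM (is_deriveZ 2 d0) d1)))).
by rewrite /riccati2 /GRing.scale_fun /GRing.scale /=; ring.
Qed.

Lemma is_derive_backlund0 : [pchar C] =i pred0 -> s ^+ 2 = 3 ->
  riccati s a (u0 t) (u1 t) != 0 ->
  u3 t = chazyXa_rhs s a (u0 t) (u1 t) ->
  is_derive t 1 (fun t => backlund0 s a (u0 t) (u1 t) (u2 t))
    (backlund1 s a (u0 t) (u1 t) (u2 t)).
Proof.
move=> C0 s2 W0 /(chazyXa_backlund C0 s2 (u2 t) _ W0).2 <-.
pose R t := riccati s a (u0 t) (u1 t).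
have dV := @is_derive_inv R t _ W0 is_derive_riccati.
have dW := is_derive_riccati1.
have E : (fun t => backlund0 s a (u0 t) (u1 t) (u2 t)) =
  (fun t => riccati1 (u0 t) (u1 t) (u2 t))
  * (fun t => (riccati s a (u0 t) (u1 t))^-1) - u0 by apply/funext.
rewrite E; apply: (is_derive_eq (is_deriveB (is_deriveM dW dV) d0)).
by rewrite /R /GRing.scale_fun /GRing.scale /=; field.
Qed.

Lemma is_derive_backlund1 :
  is_derive t 1 (fun t => backlund0 s a (u0 t) (u1 t) (u2 t))
    (backlund1 s a (u0 t) (u1 t) (u2 t)) ->
  is_derive t 1 (fun t => backlund1 s a (u0 t) (u1 t) (u2 t))
    (backlund2 s a (u0 t) (u1 t) (u2 t)).
Proof.
move=> dp; have dW := is_derive_riccati.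
set c := (- s - 1) * g1_param s a.
have E : (fun t => backlund1 s a (u0 t) (u1 t) (u2 t)) =
  (unit_factor s / 8 \*: (fun t => riccati s a (u0 t) (u1 t)) - cst (c / 8)
   - (fun t => backlund0 s a (u0 t) (u1 t) (u2 t)) ^+ 2).
  apply/funext => r.
  by rewrite /backlund1 -/c !fctE /GRing.scale_fun /GRing.scale /=; ring.
rewrite E; apply: (is_derive_eq (is_deriveB (is_deriveB
  (is_deriveZ (unit_factor s / 8) dW) (is_derive_cst _ _ _)) (is_deriveX 2 dp))).
by rewrite /backlund2 /GRing.scale_fun /GRing.scale /=; ring.
Qed.

Lemma is_derive_backlund2 :
  is_derive t 1 (fun t => backlund0 s a (u0 t) (u1 t) (u2 t))
    (backlund1 s a (u0 t) (u1 t) (u2 t)) ->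
  is_derive t 1 (fun t => backlund1 s a (u0 t) (u1 t) (u2 t))
    (backlund2 s a (u0 t) (u1 t) (u2 t)) ->
  is_derive t 1 (fun t => backlund2 s a (u0 t) (u1 t) (u2 t))
    (backlund3 s a (u0 t) (u1 t) (u2 t) (u3 t)).
Proof.
move=> dp dp'; have dW := is_derive_riccati1.
have E : (fun t => backlund2 s a (u0 t) (u1 t) (u2 t)) =
  (unit_factor s / 8 \*: (fun t => riccati1 (u0 t) (u1 t) (u2 t))
   - (2 \*: (fun t => backlund0 s a (u0 t) (u1 t) (u2 t))) *
    (fun t => backlund1 s a (u0 t) (u1 t) (u2 t))).
  apply/funext => r.
  by rewrite /backlund2 !fctE /GRing.scale_fun /GRing.scale /=; ring.
rewrite E; apply: (is_derive_eq (is_deriveB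
  (is_deriveZ (unit_factor s / 8) dW) (is_deriveM (is_deriveZ 2 dp) dp'))).
by rewrite /backlund3 /GRing.scale_fun /GRing.scale /=; ring.
Qed.

End Backlund.

(** The functions q1, q2, q3 are p', p'', p''' written through u, u', u''; the
chain of derivatives is verified for q0, which agrees with p on U only. *)
Lemma g1_chazyXb_solution a U u : open U -> chazyXa_solution a U u ->
  (forall t, U t -> g1_den (sqrtC 3) a (u t) (u^`()%classic t) != 0) ->
  chazyXb_solution (g1_param (sqrtC 3) a) U
    (fun t => g1 (sqrtC 3) a (u t) (u^`()%classic t) (u^`(2)%classic t)).
Proof.
move=> Uo sol den0; set s : C := sqrtC 3.
have s2 : s ^+ 2 = 3 := sqrtCK 3.
have C0 : [pchar C] =i pred0 := @pchar_num C.
have du := is_derive_solution sol.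
have W0 t : U t -> riccati s a (u t) (u^`()%classic t) != 0.
  by move=> /den0; rewrite g1_denE; apply: contraNneq => ->; rewrite mulr0.
pose u3 t := chazyXa_rhs s a (u t) (u^`()%classic t).
pose q0 t := backlund0 s a (u t) (u^`()%classic t) (u^`(2)%classic t).
pose q1 t := backlund1 s a (u t) (u^`()%classic t) (u^`(2)%classic t).
pose q2 t := backlund2 s a (u t) (u^`()%classic t) (u^`(2)%classic t).
pose q3 t := backlund3 s a (u t) (u^`()%classic t) (u^`(2)%classic t) (u3 t).
have g1q t : U t -> q0 t = g1 s a (u t) (u^`()%classic t) (u^`(2)%classic t).
  by move=> Ut; rewrite (g1E C0 s2 _ (W0 t Ut)).
have dq0 t : U t -> is_derive t 1 q0 (q1 t).
  move=> Ut; have [d0 d1 d2] := du t Ut.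
  exact: (@is_derive_backlund0 s a _ _ _ u3 t d0 d1 d2 C0 s2 (W0 t Ut) erefl).
have dq1 t : U t -> is_derive t 1 q1 (q2 t).
  move=> Ut; have [d0 d1 d2] := du t Ut.
  exact: (is_derive_backlund1 d0 d1 (dq0 t Ut)).
have dq2 t : U t -> is_derive t 1 q2 (q3 t).
  move=> Ut; have [d0 d1 d2] := du t Ut.
  exact: (@is_derive_backlund2 s a _ _ _ u3 t d0 d1 d2 (dq0 t Ut) (dq1 t Ut)).
apply: (@ode3_solutionI _ U _ q1 q2 q3 Uo) dq1 dq2 _ => t Ut.
  exact: (eq_on_is_derive Uo Ut g1q (dq0 t Ut)).
by rewrite -(g1q t Ut); exact: (backlund3_chazyXb C0 s2 _ (W0 t Ut) (erefl _)).
Qed.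

End Analysis.

Theorem theorem13p7 (R : realType) (alpha : Cplx R) :
  (forall (U : set (Cplx R)) (u : Cplx R -> Cplx R),
     open U ->
     chazyXa_solution alpha U u ->
     (forall t, U t -> g1_den (sqrtC 3) alpha (u t) (u^`()%classic t) != 0) ->
     chazyXb_solution (g1_param (sqrtC 3) alpha) U
       (fun t => g1 (sqrtC 3) alpha (u t) (u^`()%classic t) (u^`(2)%classic t)))
  /\ birational (g1_map alpha).
Proof.
split; last exact: birational_g1_map.
by move=> U u; exact: g1_chazyXb_solution.
Qed.
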